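(* Suppose $A\in\Gamma$ admits a factorization $A=TT^*$ with $T\in\Pi_2(\ell_2,\ell_1)$. Then $A\in\Gamma_+$. Moreover, for any eigendecomposition $A=\sum_k\lambda_ke_ke_k^*$, $$\gamma_+(A)\le\sum_k\|A^{1/2}e_k\|_1^2=\sum_k\lambda_k\|e_k\|_1^2\le\pi_2(T)^2<\infty.$$
   Context: Scalars are $\mathbb{R}$ or $\mathbb{C}$; $\ell_p=\ell_p(\mathbb{N})$ with standard basis $(\delta_k)$; for $x\in\ell_2$, $xx^*$ is the rank-one operator $v\mapsto\langle v,x\rangle x$. $\Gamma$ is the set of bounded self-adjoint operators $A:\ell_2\to\ell_2$ with $\langle Ax,x\rangle\ge0$ for all $x\in\ell_2$ and $\|A\|_{1,1}:=\sum_{k,l}|\langle A\delta_k,\delta_l\rangle|<\infty$. For $A\in\Gamma$, $\gamma_+(A):=\inf\{\sum_{k=1}^\infty\|x_k\|_1^2: (x_k)\subset\ell_1,\ A=\sum_{k=1}^\infty x_kx_k^*\text{ strongly}\}$ with $\inf\varnothing=\infty$, and $\Gamma_+:=\{A\in\Gamma:\gamma_+(A)<\infty\}$. A linear operator $T:X\to Y$ between Banach spaces is 2-summing if there is $C\ge0$ such that for every finite collection $x_1,\dots,x_N\in X$, $\sum_{k=1}^N\|Tx_k\|_Y^2\le C^2\sup_{x^*\in B_{X^*}}\sum_{k=1}^N|\langle x^*,x_k\rangle|^2$, where $B_{X^*}$ is the closed unit ball of $X^*$; the infimum of such $C$ is $\pi_2(T)$, and $\Pi_2(X,Y)$ is the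 space of 2-summing operators. In $A=TT^*$, $T$ is regarded as an operator $\ell_2\to\ell_2$ via $\ell_1\subset\ell_2$ and $T^*$ is its adjoint. An eigendecomposition is a strongly convergent expansion with $(e_k)$ an orthonormal sequence of eigenvectors of $A$ in $\ell_2$, $Ae_k=\lambda_ke_k$, $\lambda_k\ge0$; terms with $\lambda_k=0$ contribute $0$ to the sums (convention $0\cdot\infty=0$). $A^{1/2}$ is the positive square root of $A$ on $\ell_2$. *)

(* Defs.v *)
From HB Require Import structures.
From mathcomp Require Import all_boot all_order all_algebra.
From mathcomp Require Import complex.
From mathcomp Require Import all_classical all_reals all_analysis.

Set Implicit Arguments.
Unset Strict Implicit.
Unset Printing Implicit Defensive.

Import Order.TTheory GRing.Theory Num.Theory.
Import numFieldNormedType.Exports.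

Local Open Scope classical_set_scope.
Local Open Scope ring_scope.

Variant scalars := RealScalars | ComplexScalars.

Definition scal (R : realType) (F : scalars) : numFieldType :=
  match F with
  | RealScalars => R
  | ComplexScalars => R[i]
  end.

Section Scalars.
Context {R : realType} {F : scalars}.

Definition conj_scal : scal R F -> scal R F :=
  match F return scal R F -> scal R F with
  | RealScalars => id
  | ComplexScalars => @conjc R
  end.

Definition re_scal : scal R F -> R :=
  match F return scal R F -> R with
  | RealScalars => id
  | ComplexScalars => @complex.Re R
  end.

Definition of_real : R -> scal R F :=
  match F return R -> scal R F with
  | RealScalars => id
  | ComplexScalars => @real_complex_def R (Phant R)
  end.

(* Library norms over [scal R F] take their values in [scal R F], where they
   are real and nonnegative; [rnorm] is the same norm with values in [R]. *)
Definition rnorm (V : normedZmodType (scal R F)) (v : V) : R :=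
  re_scal `|v|.

End Scalars.

Section Scalars_theory.
Context {R : realType}.

Lemma of_realK F : cancel (@of_real R F) re_scal.
Proof. by case: F. Qed.

Lemma of_real_rnorm F (V : normedZmodType (scal R F)) (v : V) :
  of_real (rnorm v) = `|v|.
Proof.
rewrite /rnorm; have := normr_ge0 v; move: `|v|; case: F V v => //= V v [a b].
by rewrite lecE /= => /andP[/eqP -> _].
Qed.

Lemma of_realD F (a b : R) : of_real (a + b) = of_real a + of_real b :> scal R F.
Proof. by case: F => //=; rewrite -rmorphD. Qed.

Lemma of_realM F (a b : R) : of_real (a * b) = of_real a * of_real b :> scal R F.
Proof. by case: F => //=; rewrite -rmorphM. Qed.

Lemma of_real0 F : of_real 0 = 0 :> scal R F.
Proof. by case: F. Qed.

Lemma ler_of_real F (a b : R) : (of_real a <= of_real b :> scal R F) = (a <= b).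
Proof. by case: F => //=; rewrite lecR. Qed.

Lemma of_real_inj F : injective (@of_real R F).
Proof. exact: can_inj (@of_realK F). Qed.

Section norm.
Context {F : scalars}.

Lemma rnorm_ge0 (V : normedZmodType (scal R F)) (v : V) : 0 <= rnorm v.
Proof. by rewrite -(ler_of_real F) of_real0 of_real_rnorm. Qed.

Lemma ler_rnormD (V : normedZmodType (scal R F)) (v w : V) :
  rnorm (v + w) <= rnorm v + rnorm w.
Proof. by rewrite -(ler_of_real F) of_realD !of_real_rnorm ler_normD. Qed.

Lemma rnormM (a b : scal R F) : rnorm (a * b) = rnorm a * rnorm b.
Proof. by apply: (@of_real_inj F); rewrite of_realM !of_real_rnorm normrM. Qed.

Lemma rnorm0_eq0 (V : normedZmodType (scal R F)) (v : V) :
  rnorm v = 0 -> v = 0.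
Proof. by move=> v0; apply/normr0_eq0; rewrite -of_real_rnorm v0 of_real0. Qed.

Lemma rnorm0 (V : normedZmodType (scal R F)) : rnorm (0 : V) = 0.
Proof. by apply: (@of_real_inj F); rewrite of_real_rnorm of_real0 normr0. Qed.

End norm.
End Scalars_theory.

Section Lp.
Context {R : realType} {F : scalars}.
Local Notation K := (scal R F).

(* The l_p-norm of an arbitrary scalar sequence, possibly infinite. *)
Definition lpnorm (p : R) (x : nat -> K) : \bar R :=
  ('N[counting]_p%:E[EFin \o @rnorm R F K \o x])%E.

Lemma lpnormE (p : R) (x : nat -> K) : 0 < p ->
  lpnorm p x = ((\sum_(k <oo) ((rnorm (x k)) `^ p)%:E) `^ p^-1)%E.
Proof.
move=> p0; rewrite /lpnorm Lnorm_counting//; congr (_ `^ _)%E.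
by apply: eq_eseriesr => k _; rewrite /= ger0_norm ?rnorm_ge0// poweR_EFin.
Qed.

Lemma lpnorm_ge0 p x : (0 <= lpnorm p x)%E.
Proof. exact: Lnorm_ge0. Qed.

Section norm_properties.
Variable p : R.
Hypothesis p1 : 1 <= p.
Let p0 : 0 < p. Proof. exact: lt_le_trans p1. Qed.

Lemma lpnormD x y : (lpnorm p (x + y)%R <= lpnorm p x + lpnorm p y)%E.
Proof.
apply: (@le_trans _ _
  ('N[counting]_p%:E[EFin \o ((@rnorm R F K \o x) \+ (@rnorm R F K \o y))%R])%E).
  rewrite lpnormE// Lnorm_counting//.
  apply: gt0_ler_poweR.
  - by rewrite invr_ge0 ltW.
  - by rewrite in_itv/= leey andbT nneseries_ge0// => k _ _; rewrite lee_fin powR_ge0.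
  - by rewrite in_itv/= leey andbT nneseries_ge0// => k _ _; exact: poweR_ge0.
  apply: lee_nneseries => k _; first by rewrite lee_fin powR_ge0.
  rewrite /= lee_fin ge0_ler_powR ?nnegrE ?rnorm_ge0 ?(ltW p0)//.
  exact: le_trans (ler_rnormD _ _) (ler_norm _).
exact: minkowski_EFin.
Qed.

Lemma lpnormZ a x : lpnorm p (a *: x) = ((rnorm a)%:E * lpnorm p x)%E.
Proof.
rewrite !lpnormE//.
under eq_eseriesr do rewrite rnormM powRM ?rnorm_ge0// EFinM.
rewrite nneseriesZl; last by move=> k _; rewrite lee_fin powR_ge0.
rewrite poweRM ?lee_fin ?powR_ge0//; last first.
  by rewrite nneseries_ge0// => k _ _; rewrite lee_fin powR_ge0.
rewrite -poweR_EFin -poweRrM divff ?gt_eqF// poweRe1//.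
by rewrite lee_fin rnorm_ge0.
Qed.

Lemma lpnorm_coord x k : ((rnorm (x k))%:E <= lpnorm p x)%E.
Proof.
rewrite lpnormE//.
have -> : (rnorm (x k))%:E = ((rnorm (x k) `^ p)%:E `^ p^-1)%E.
  by rewrite poweR_EFin -powRrM divff ?gt_eqF// powRr1// rnorm_ge0.
have h i : (0 <= (rnorm (x i) `^ p)%:E)%E by rewrite lee_fin powR_ge0.
apply: gt0_ler_poweR.
- by rewrite invr_ge0 ltW.
- by rewrite in_itv/= leey andbT.
- by rewrite in_itv/= leey andbT nneseries_ge0.
apply: le_trans (nneseries_lim_ge k.+1 _) => //.
rewrite big_mkord big_ord_recr/= leeDr// sume_ge0//.
Qed.

Lemma lpnorm_eq0 x : lpnorm p x = 0%E -> x = 0.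
Proof.
move=> x0; apply/funext => k; apply: rnorm0_eq0; apply/eqP.
by rewrite eq_le rnorm_ge0 andbT -lee_fin (le_trans (lpnorm_coord x k))// x0.
Qed.

Lemma lpnorm0 : lpnorm p 0 = 0%E.
Proof. by rewrite -[0 : nat -> K](scale0r 0) lpnormZ rnorm0 mul0e. Qed.
End norm_properties.
End Lp.

Definition lp_pred (R : realType) (F : scalars) (p : R) :
    {pred nat -> scal R F} := mem [set x | (lpnorm p x < +oo)%E].
Arguments lp_pred {R} F p.

(* The Banach space l_p(N); the proof [p1] is a parameter of the type because
   its norm is one only for [1 <= p]. *)
Record lp (R : realType) (F : scalars) (p : R) (p1 : 1 <= p) :=
  Lp { lp_seq :> nat -> scal R F; _ : lp_seq \in lp_pred F p }.
Arguments lp_seq {R F p p1} _ _.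
Arguments Lp {R F p p1} lp_seq _.

Section LpSpace.
Context {R : realType} (F : scalars) (p : R) (p1 : 1 <= p).
Local Notation K := (scal R F).
Local Notation lp := (@lp R F p p1).
Local Notation lp_pred := (lp_pred F p).

HB.instance Definition _ := [isSub for @lp_seq R F p p1].
HB.instance Definition _ := [Choice of lp by <:].

Lemma lpP (x : lp) : (lpnorm p x < +oo)%E.
Proof. by case: x => x /=; rewrite inE. Qed.

Lemma lp_submod_closed : submod_closed lp_pred.
Proof.
split; first by rewrite inE /= (lpnorm0 p1) ltry.
move=> a x y; rewrite !inE /= => fx fy.
apply: le_lt_trans (lpnormD p1 _ _) _; rewrite (lpnormZ p1) lte_add_pinfty//.
by rewrite lte_mul_pinfty// lee_fin rnorm_ge0.
Qed.

HB.instance Definition _ := GRing.isSubmodClosed.Build K (nat -> K) lp_pred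
  lp_submod_closed.
HB.instance Definition _ := [SubChoice_isSubLmodule of lp by <:].

Definition lp_norm (x : lp) : K := of_real (fine (lpnorm p x)).

Let fin_lp (x : lp) : lpnorm p x \is a fin_num.
Proof. by rewrite ge0_fin_numE ?lpnorm_ge0 ?lpP. Qed.

Lemma lp_normD (x y : lp) : lp_norm (x + y) <= lp_norm x + lp_norm y.
Proof.
rewrite /lp_norm -of_realD ler_of_real -lee_fin EFinD !fineK//.
exact: lpnormD.
Qed.

Lemma lp_normZ (a : K) (x : lp) : lp_norm (a *: x) = `|a| * lp_norm x.
Proof.
rewrite /lp_norm -[`|a|]of_real_rnorm -of_realM; congr of_real.
by rewrite [lp_seq _](_ : _ = a *: (x : nat -> K))// (lpnormZ p1) fineM.
Qed.

Lemma lp_norm0_eq0 (x : lp) : lp_norm x = 0 -> x = 0.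
Proof.
rewrite /lp_norm -(@of_real0 R F) => /of_real_inj x0.
have x0' : lpnorm p x = 0%E by rewrite -[LHS]fineK// x0.
exact/val_inj/(lpnorm_eq0 p1 x0').
Qed.

HB.instance Definition _ := @Lmodule_isNormed.Build K lp lp_norm
  lp_normD lp_normZ lp_norm0_eq0.

Lemma rnorm_lpE (x : lp) : rnorm x = fine (lpnorm p x).
Proof. by rewrite /rnorm /Num.norm /= /lp_norm of_realK. Qed.

End LpSpace.

Lemma le1_2 (R : realType) : 1 <= 2 :> R.
Proof. by rewrite ler1n. Qed.

Notation ell1 R F := (@lp R F 1 (lexx 1)).
Notation ell2 R F := (@lp R F 2 (le1_2 R)).

Lemma rnorm_ell1E (R : realType) F (x : ell1 R F) :
  (rnorm x)%:E = (\sum_(k <oo) (rnorm (x k))%:E)%E.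
Proof.
have fx : lpnorm 1 x \is a fin_num by rewrite ge0_fin_numE ?lpnorm_ge0 ?lpP.
rewrite rnorm_lpE fineK// lpnormE// invr1 poweRe1; last first.
  by rewrite nneseries_ge0// => *; rewrite lee_fin powR_ge0.
by apply: eq_eseriesr => k _; rewrite powRr1 ?rnorm_ge0.
Qed.

Lemma rnorm_ell2E (R : realType) F (x : ell2 R F) :
  (rnorm x ^+ 2)%:E = (\sum_(k <oo) (rnorm (x k) ^+ 2)%:E)%E.
Proof.
have fx : lpnorm 2 x \is a fin_num by rewrite ge0_fin_numE ?lpnorm_ge0 ?lpP.
rewrite rnorm_lpE -powR_mulrn ?fine_ge0 ?lpnorm_ge0//.
rewrite -poweR_EFin fineK// lpnormE// -poweRrM mulVf// poweRe1; last first.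
  by rewrite nneseries_ge0// => *; rewrite lee_fin powR_ge0.
by apply: eq_eseriesr => k _; rewrite powR_mulrn ?rnorm_ge0.
Qed.

Section Operators.
Context {R : realType} {F : scalars}.
Local Notation K := (scal R F).
Local Notation ell1 := (ell1 R F).
Local Notation ell2 := (ell2 R F).

Lemma delta_subproof (k : nat) :
  (fun j => (j == k)%:R : K) \in lp_pred F 2.
Proof.
rewrite inE /= lpnormE// poweR_lty// (nneseries_split 0 k.+1); last first.
  by move=> j _; rewrite lee_fin powR_ge0.
rewrite add0n eseries0 ?adde0; last first.
  move=> i ki _ /=; rewrite gtn_eqF//= rnorm0 powR0//.
by under eq_bigr do rewrite -[_%:E]/(EFin _); rewrite sumEFin ltry.
Qed.

Definition delta (k : nat) : ell2 := Lp _ (delta_subproof k).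

Lemma lp_1_sub_2 (x : ell1) : (x : nat -> K) \in lp_pred F 2.
Proof.
have p01 : 0 < 1 :> R by [].
have p02 : 0 < 2 :> R by [].
have fx : lpnorm 1 x \is a fin_num by rewrite ge0_fin_numE ?lpnorm_ge0 ?lpP.
rewrite inE /= lpnormE// poweR_lty//.
apply: (@le_lt_trans _ _
  (\sum_(k <oo) ((fine (lpnorm 1 x))%:E * (rnorm (x k) `^ 1)%:E)))%E.
  apply: lee_nneseries => k _; first by rewrite lee_fin powR_ge0.
  rewrite -EFinM lee_fin powRr1 ?rnorm_ge0// powR_mulrn ?rnorm_ge0// expr2.
  rewrite ler_wpM2r ?rnorm_ge0// -lee_fin fineK//.
  by apply: lpnorm_coord.
rewrite nneseriesZl; last by move=> k _; rewrite lee_fin powR_ge0.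
rewrite fineK// lte_mul_pinfty ?lpnorm_ge0//.
have := lpP x; rewrite lpnormE// => /lty_poweRy; apply.
by rewrite invr1.
Qed.

Definition incl (x : ell1) : ell2 := Lp _ (lp_1_sub_2 x).

(* Linear in the first argument. *)
Definition inner (x y : ell2) : K :=
  limn (series (fun k => x k * conj_scal (y k))).

(* The rank-one operator [x x^*]. *)
Definition rank_one (x v : ell2) : ell2 := inner v x *: x.

(* Convergence is in the norm of l_2, separately for each [v]. *)
Definition strong_sum (B : nat -> ell2 -> ell2) (A : ell2 -> ell2) : Prop :=
  forall v, series (fun k => B k v) @ \oo --> A v.

Definition bounded_op (A : ell2 -> ell2) : Prop :=
  exists M : R, forall x, rnorm (A x) <= M * rnorm x.

Definition is_adjoint (S S' : ell2 -> ell2) : Prop :=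
  forall x y, inner (S x) y = inner x (S' y).

Definition self_adjoint (A : ell2 -> ell2) : Prop := is_adjoint A A.

(* The order of [K] makes this say that [<Ax,x>] is real and nonnegative. *)
Definition nonneg_op (A : ell2 -> ell2) : Prop := forall x, 0 <= inner (A x) x.

Definition norm11 (A : ell2 -> ell2) : \bar R :=
  \esum_(kl in [set: nat * nat])
    (rnorm (inner (A (delta kl.1)) (delta kl.2)))%:E.

Definition Gamma : set {linear ell2 -> ell2} :=
  [set A | [/\ bounded_op A, self_adjoint A, nonneg_op A & (norm11 A < +oo)%E]].

Definition gamma_plus (A : {linear ell2 -> ell2}) : \bar R :=
  ereal_inf [set (\sum_(k <oo) (rnorm (x k) ^+ 2)%:E)%E
            | x in [set x : nat -> ell1 |
                    strong_sum (fun k => rank_one (incl (x k))) A]].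

Definition Gamma_plus : set {linear ell2 -> ell2} :=
  [set A | Gamma A /\ (gamma_plus A < +oo)%E].

Definition is_positive_sqrt (A S : {linear ell2 -> ell2}) : Prop :=
  [/\ bounded_op S, self_adjoint S, nonneg_op S & forall x, S (S x) = A x].

(* The positive square root of [A] if it has one, and [0] otherwise. *)
Definition sqrt_op (A : {linear ell2 -> ell2}) : {linear ell2 -> ell2} :=
  if pselect (exists S, is_positive_sqrt A S) is left ex_S
  then projT1 (cid ex_S) else \0.

(* [A = T T^*], where [T] is viewed as an operator on l_2 and [T^*], the adjoint
   of that operator, is given by its defining identity. *)
Definition factors_through (A : {linear ell2 -> ell2})
    (T : {linear ell2 -> ell1}) : Prop :=
  exists2 Tstar : {linear ell2 -> ell2},
    is_adjoint (incl \o T) Tstar & forall x, A x = incl (T (Tstar x)).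

Definition orthonormal (e : nat -> ell2) : Prop :=
  forall j k, inner (e j) (e k) = (j == k)%:R.

Definition eigendecomposition (A : {linear ell2 -> ell2})
    (lambda : nat -> R) (e : nat -> ell2) : Prop :=
  [/\ orthonormal e,
      forall k, 0 <= lambda k,
      forall k, A (e k) = of_real (lambda k) *: e k &
      strong_sum (fun k v => of_real (lambda k) *: rank_one (e k) v) A].

End Operators.

Section TwoSumming.
Context {R : realType} {F : scalars}.
Local Notation K := (scal R F).

Definition dual_ball (X : normedModType K) : set {linear X -> K^o} :=
  [set f | forall x, rnorm (f x) <= rnorm x].

Definition two_summing_bound (X Y : normedModType K)
    (T : {linear X -> Y}) (C : R) : Prop :=
  0 <= C /\
  forall (N : nat) (x : 'I_N -> X),
    ((\sum_(k < N) rnorm (T (x k)) ^+ 2)%:E <=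
     (C ^+ 2)%:E *
     ereal_sup [set (\sum_(k < N) rnorm (f (x k)) ^+ 2)%:E
               | f in @dual_ball X])%E.

Definition two_summing (X Y : normedModType K) (T : {linear X -> Y}) : Prop :=
  exists C : R, two_summing_bound T C.

Definition pi2 (X Y : normedModType K) (T : {linear X -> Y}) : \bar R :=
  ereal_inf [set C%:E | C in two_summing_bound T].

End TwoSumming.

(* Main.v *)
(* A square-summable expansion of A = T T^* is obtained by transporting an
   orthonormal system through T: the basis expansion of T^* v, pushed forward by
   T, gives A = sum_k (T delta_k)(T delta_k)^*.  If phi lies in the unit ball of
   the dual and (f_k) is orthogonal with |f_k| <= 1, testing phi on
   sum_k conj(phi(f_k)) f_k gives sum_k |phi(f_k)|^2 <= 1, so that
   sum_k |T f_k|_1^2 <= pi_2(T)^2; with f_k = delta_k this bounds gamma_+(A).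
   For an eigendecomposition, the vectors f_k = T^* e_k / sqrt(lambda_k) (read
   as 0 when lambda_k = 0) are orthogonal of norm at most 1 and
   T f_k = sqrt(lambda_k) e_k = A^{1/2} e_k, which yields the three relations
   for (lambda_k, e_k).  The positive square root of A exists because
   v |-> sum_k sqrt(lambda_k) <v, e_k> e_k converges, and its value at e_k does
   not depend on the choice of the root. *)
From HB Require Import structures.
From mathcomp Require Import all_boot all_order all_algebra complex lra.
From mathcomp Require Import all_classical all_reals all_analysis.
Require Import Defs.

Set Implicit Arguments.
Unset Strict Implicit.
Unset Printing Implicit Defensive.

Import Order.TTheory GRing.Theory Num.Theory.
Import numFieldNormedType.Exports.
Local Open Scope classical_set_scope.
Local Open Scope ring_scope.

(** * Conjugation, real part and real-valued norm over both scalar fields *)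

Section Scalars.
Context {R : realType} {F : scalars}.
Local Notation K := (scal R F).
Implicit Types a b : K.

Lemma conj_scalD : {morph @conj_scal R F : a b / a + b}.
Proof. by case: F => //= a b; rewrite rmorphD. Qed.

Lemma conj_scalN : {morph @conj_scal R F : a / - a}.
Proof. by case: F => //= a; rewrite rmorphN. Qed.

Lemma conj_scalM : {morph @conj_scal R F : a b / a * b}.
Proof. by case: F => //= a b; rewrite rmorphM. Qed.

Lemma conj_scalK : involutive (@conj_scal R F).
Proof. by case: F => //=; exact: conjcK. Qed.

Lemma conj_scal_of_real (r : R) : conj_scal (of_real r) = of_real r :> K.
Proof. by case: F => //=; exact: conjc_real. Qed.

Lemma of_realN (r : R) : of_real (- r) = - of_real r :> K.
Proof. by case: F => //=; rewrite -rmorphN. Qed.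

Lemma of_real1 : of_real 1 = 1 :> K.
Proof. by case: F. Qed.

Lemma conj_scal_nat n : conj_scal n%:R = n%:R :> K.
Proof. by case: F => //=; exact: conjc_nat. Qed.

Lemma re_scalD : {morph @re_scal R F : a b / a + b}.
Proof. by case: F => //= a b; rewrite raddfD. Qed.

Lemma re_scalN : {morph @re_scal R F : a / - a}.
Proof. by case: F => //= a; rewrite raddfN. Qed.

Lemma rnorm_conj a : rnorm (conj_scal a) = rnorm a.
Proof.
by rewrite /rnorm; congr re_scal; case: F a => // a; exact: normcJ.
Qed.

Lemma rnorm_of_real (r : R) : rnorm (of_real r : K) = `|r|.
Proof.
rewrite /rnorm; case: F => //=.
by rewrite expr0n addr0 sqrtr_sqr.
Qed.

Lemma mul_conj_scal a : a * conj_scal a = of_real (rnorm a ^+ 2).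
Proof.
rewrite expr2 of_realM of_real_rnorm -expr2.
case: F a => //= a; first by rewrite -expr2 -(real_normK (num_real a)).
by symmetry; exact: sqr_normc.
Qed.

Lemma of_real_ge0 a : 0 <= a -> a = of_real (re_scal a).
Proof.
case: F a => //= -[x y]; rewrite lecE /= => /andP[/eqP -> _] //.
Qed.

Lemma ler_re_scal a : `|re_scal a| <= rnorm a.
Proof.
rewrite -(ler_of_real F) of_real_rnorm; case: F a => //= a.
exact: normc_ge_Re.
Qed.

Lemma rnorm_sum (V : normedZmodType K) (I : Type) (s : seq I) (P : pred I)
    (f : I -> V) :
  rnorm (\sum_(i <- s | P i) f i) <= \sum_(i <- s | P i) rnorm (f i).
Proof.
elim/big_ind2 : _ => [|x1 x2 y1 y2 h1 h2|//]; first by rewrite rnorm0.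
exact: le_trans (ler_rnormD _ _) (lerD h1 h2).
Qed.

Lemma of_real_sum (I : Type) (s : seq I) (P : pred I) (f : I -> R) :
  of_real (\sum_(i <- s | P i) f i) = \sum_(i <- s | P i) of_real (f i) :> K.
Proof. by elim/big_rec2 : _ => [|i x y _ <-]; rewrite ?of_real0 ?of_realD. Qed.

Lemma conj_scal_sum (I : Type) (s : seq I) (P : pred I) (f : I -> K) :
  conj_scal (\sum_(i <- s | P i) f i) = \sum_(i <- s | P i) conj_scal (f i).
Proof.
elim/big_rec2 : _ => [|i x y _ <-]; last by rewrite conj_scalD.
exact: conj_scal_nat 0%N.
Qed.

Lemma rnormN (V : normedZmodType K) (v : V) : rnorm (- v) = rnorm v.
Proof. by rewrite /rnorm normrN. Qed.

Lemma rnormB (V : normedZmodType K) (v w : V) : rnorm (v - w) = rnorm (w - v).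
Proof. by rewrite -rnormN opprB. Qed.

Lemma rnormZ (V : normedModType K) a (v : V) :
  rnorm (a *: v) = rnorm a * rnorm v.
Proof.
by apply: (@of_real_inj R F); rewrite of_realM !of_real_rnorm normrZ.
Qed.

End Scalars.

(** * Convergence measured by real-valued norms, and completeness of the scalars *)

Section Convergence.
Context {R : realType} {F : scalars}.
Local Notation K := (scal R F).

Lemma cvg_rnormP (V : normedModType K) (u : nat -> V) (l : V) :
  u @ \oo --> l <->
  forall e : R, 0 < e -> \forall n \near \oo, rnorm (l - u n) < e.
Proof.
have ltE (a b : R) : (of_real a < of_real b :> K) = (a < b).
  by rewrite !lt_neqAle ler_of_real (inj_eq (@of_real_inj R F)).
split=> [/cvgrPdist_lt h e e0|h].
  have := h (of_real e).
  rewrite -[0 in X in X -> _](@of_real0 R F) ltE => /(_ e0).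
  by apply: filterS => n; rewrite -of_real_rnorm ltE.
apply/cvgrPdist_lt => e e0.
have eE := of_real_ge0 (ltW e0).
move: e0; rewrite eE -[0](@of_real0 R F) ltE => /h.
by apply: filterS => n; rewrite -of_real_rnorm ltE.
Qed.

Lemma cvg_rnorm0P (V : normedModType K) (u : nat -> V) (l : V) :
  u @ \oo --> l <-> (fun n => rnorm (u n - l)) @ \oo --> (0 : R).
Proof.
rewrite cvg_rnormP cvgrPdist_lt; split=> h e e0; have := h e e0;
  by apply: filterS => n; rewrite sub0r normrN ger0_norm ?rnorm_ge0 // rnormB.
Qed.

(** Lipschitz maps preserve limits; the form with two separate sequences also covers partial sums
    that are only afterwards recognized as images. *)
Lemma cvg_le_rnorm (V W : normedModType K) (M : R) (u : nat -> V) (l : V)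
    (w : nat -> W) (m : W) :
  (forall n, rnorm (w n - m) <= M * rnorm (u n - l)) ->
  u @ \oo --> l -> w @ \oo --> m.
Proof.
move=> h /cvg_rnorm0P ul; apply/cvg_rnorm0P.
have : (fun n => M * rnorm (u n - l)) @ \oo --> (0 : R).
  by rewrite -(mulr0 M); apply: cvgM => //; exact: cvg_cst.
move=> hM.
apply: (@squeeze_cvgr _ _ _ _ (fun=> 0) (fun n => M * rnorm (u n - l))) => //.
  by near=> n; rewrite rnorm_ge0 h.
exact: cvg_cst.
Unshelve. all: by end_near. Qed.

Lemma cvg_eq_unique (V : normedModType K) (u v : nat -> V) (l m : V) :
  u =1 v -> u @ \oo --> l -> v @ \oo --> m -> l = m.
Proof.
by move=> /funext -> vl vm; apply: cvg_unique vl vm; exact: norm_hausdorff.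
Qed.

Lemma cvg_conj_scal (u : nat -> K) (l : K) :
  u @ \oo --> l -> conj_scal \o u @ \oo --> conj_scal l.
Proof.
apply: (@cvg_le_rnorm _ _ 1) => n /=.
by rewrite -conj_scalN -conj_scalD rnorm_conj mul1r.
Qed.

Lemma cvg_of_real (u : nat -> R) (l : R) :
  u @ \oo --> l -> (fun n => of_real (u n) : K) @ \oo --> (of_real l : K).
Proof.
move=> /cvgrPdist_lt ul; apply/cvg_rnormP => e e0; have := ul e e0.
by apply: filterS => n; rewrite -of_realN -of_realD rnorm_of_real.
Qed.

Lemma cvg_re_scal (u : nat -> K) (l : K) :
  u @ \oo --> l -> (fun n => re_scal (u n)) @ \oo --> re_scal l.
Proof.
move=> /cvg_rnormP ul; apply/cvgrPdist_lt => e e0; have := ul e e0.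
apply: filterS => n; apply: le_lt_trans.
by rewrite -re_scalN -re_scalD ler_re_scal.
Qed.

Lemma cvg_rnorm (V : normedModType K) (u : nat -> V) (l : V) :
  u @ \oo --> l -> (fun n => rnorm (u n)) @ \oo --> rnorm l.
Proof.
move=> ul; apply: (@cvg_re_scal (fun n => `|u n|) `|l|).
exact: cvg_norm.
Qed.

(** Lets completeness be proved once for both fields: in the real case [im] and [i] are both 0, in
    the complex case they are the usual ones. *)
Lemma scal_parts : exists (im : K -> R) (i : K),
  [/\ {morph im : a b / a - b}, forall a, `|im a| <= rnorm a, rnorm i <= 1 &
      forall a, a = of_real (re_scal a) + i * of_real (im a)].
Proof.
have ImE (a : R[i]) : complex.Im a = - complex.Re (a * 'i%C).
  by rewrite ReiNIm opprK.
case: F => [|].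
  exists (fun=> 0), 0; split=> [a b|a|| a]; rewrite ?subr0 ?normr0 ?rnorm_ge0//.
    by rewrite rnorm0.
  by rewrite mul0r addr0.
have rnormi : @rnorm R ComplexScalars _ ('i%C : scal R ComplexScalars) = 1.
  by rewrite /rnorm /= expr0n add0r expr1n sqrtr1.
exists (@complex.Im R), ('i%C : scal R ComplexScalars); split=> [a b|a||a].
- by rewrite raddfB.
- rewrite -[leRHS]mulr1 -rnormi -rnormM ImE normrN.
  exact: (@ler_re_scal R ComplexScalars).
- by rewrite rnormi.
- exact: complexE.
Qed.

Lemma cauchy_scal_cvg (u : nat -> K) :
  (forall e : R, 0 < e -> exists N, forall m n, (N <= m)%N -> (N <= n)%N ->
    rnorm (u m - u n) < e) -> cvgn u.
Proof.
have real_cauchy (v : nat -> R) : (forall e : R, 0 < e -> exists N, forall m n,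
    (N <= m)%N -> (N <= n)%N -> `|v m - v n| < e) -> cvgn v.
  move=> h; apply/cauchy_cvgP/cauchy_exP => e e0.
  have [N hN] := h e e0; exists (v N); exists N => // n /= Nn.
  exact: hN.
move=> h; have [im [i [imB im_le i1 uE]]] := scal_parts.
have /cvg_ex[a /cvgrPdist_lt ua] : cvgn (fun n => re_scal (u n) : R).
  apply: real_cauchy => e /h [N hN]; exists N => m n mN nN.
  apply: le_lt_trans (hN m n mN nN).
  by rewrite -re_scalN -re_scalD ler_re_scal.
have /cvg_ex[b /cvgrPdist_lt ub] : cvgn (fun n => im (u n) : R).
  apply: real_cauchy => e /h [N hN]; exists N => m n mN nN.
  by apply: le_lt_trans (hN m n mN nN); rewrite -imB.
apply/cvg_ex; exists (of_real a + i * of_real b); apply/cvg_rnormP => e e0.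
have e20 : 0 < e / 2 by rewrite divr_gt0.
apply: filterS2 (ua _ e20) (ub _ e20) => n na nb.
rewrite [u n in X in X < _]uE opprD addrACA -mulrBr -!of_realN -!of_realD.
apply: le_lt_trans (ler_rnormD _ _) _.
rewrite rnormM !rnorm_of_real [ltRHS]splitr ltr_leD// (le_trans _ (ltW nb))//.
by rewrite ler_piMl.
Qed.

End Convergence.

(** * Passage between extended-real sums and real partial sums *)

Section NonnegativeSeries.
Context {R : realType}.
Implicit Types f : nat -> R.

Lemma nneseries_cvg_series f r : (forall k, 0 <= f k) ->
  (\sum_(k <oo) (f k)%:E)%E = r%:E -> series f @ \oo --> r.
Proof.
move=> f0 fr.
have : (fun n => \sum_(0 <= k < n) (f k)%:E)%E @ \oo --> r%:E.
  by rewrite -fr; apply: is_cvg_nneseries => k _ _; rewrite lee_fin.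
move=> /fine_cvgP[_]; apply: cvg_trans; apply: near_eq_cvg; near=> n.
by rewrite /= sumEFin.
Unshelve. all: by end_near. Qed.

Lemma nneseries_le_partial f (M : R) : (forall k, 0 <= f k) ->
  (forall n, series f n <= M) -> (\sum_(k <oo) (f k)%:E <= M%:E)%E.
Proof.
move=> f0 fM; apply: lime_le.
  by apply: is_cvg_nneseries => k _ _; rewrite lee_fin.
by near=> n; rewrite sumEFin lee_fin fM.
Unshelve. all: by end_near. Qed.

Lemma series_le_nneseries f (M : R) n : (forall k, 0 <= f k) ->
  (\sum_(k <oo) (f k)%:E <= M%:E)%E -> series f n <= M.
Proof.
move=> f0; rewrite -lee_fin; apply: le_trans.
rewrite -sumEFin; apply: nneseries_lim_ge => k _ _; by rewrite lee_fin.
Qed.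

Lemma cvg_series_tail f (r : R) : series f @ \oo --> r ->
  forall e : R, 0 < e -> exists N, forall m n, (N <= m)%N -> (m <= n)%N ->
    `|\sum_(m <= k < n) f k| < e.
Proof.
move=> fr e e0.
have e20 : 0 < e / 2 by rewrite divr_gt0.
move/cvgrPdist_lt/(_ _ e20): fr => [N _ hN]; exists N => m n Nm mn.
rewrite -sub_series_geq//.
have -> : series f n - series f m = (r - series f m) - (r - series f n) by lra.
apply: le_lt_trans (ler_normB _ _) _.
by rewrite [ltRHS]splitr ltrD// hN//= (leq_trans Nm).
Qed.

End NonnegativeSeries.

(** * The inner product of l_2: convergence, sesquilinearity, continuity *)

Section Inner.
Context {R : realType} {F : scalars}.
Local Notation K := (scal R F).
Local Notation ell2 := (ell2 R F).
Implicit Types (x y : ell2) (a b : K).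

Lemma ell2_series_sqr x :
  series (fun k => rnorm (x k) ^+ 2) @ \oo --> rnorm x ^+ 2.
Proof.
apply: nneseries_cvg_series => [k|]; first exact: sqr_ge0.
by rewrite rnorm_ell2E.
Qed.
(* A convergence statement unfolds to a product over neighborhoods, which turns
   the arguments occurring in the limit into implicit ones. *)
Arguments ell2_series_sqr : clear implicits.

Lemma ell2_series_sqrD x y :
  series (fun k => rnorm (x k) ^+ 2 + rnorm (y k) ^+ 2) @ \oo -->
  rnorm x ^+ 2 + rnorm y ^+ 2.
Proof.
rewrite [series _](_ : _ = series (fun k => rnorm (x k) ^+ 2) +
                           series (fun k => rnorm (y k) ^+ 2)).
  by apply: cvgD; exact: ell2_series_sqr.
by rewrite -seriesD.
Qed.
Arguments ell2_series_sqrD : clear implicits.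

Lemma inner_term_le a b :
  rnorm (a * conj_scal b) <= rnorm a ^+ 2 + rnorm b ^+ 2.
Proof.
rewrite rnormM rnorm_conj; have := rnorm_ge0 a; have := rnorm_ge0 b.
by move: (rnorm a) (rnorm b) => s t *; nra.
Qed.

(** [inner] is defined by [limn], which is meaningful only once the series converges. Its blocks of
    terms are dominated by those of the convergent series of [|x_k|^2 + |y_k|^2], so it is
    Cauchy. *)
Lemma inner_cvg x y :
  series (fun k => x k * conj_scal (y k)) @ \oo --> inner x y.
Proof.
suff : cvgn (series (fun k => x k * conj_scal (y k))) by [].
have /cvg_series_tail tail := ell2_series_sqrD x y.
apply: cauchy_scal_cvg => e /tail[N hN].
have bound m n : (N <= m)%N -> (m <= n)%N ->
    rnorm (series (fun k => x k * conj_scal (y k)) n -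
           series (fun k => x k * conj_scal (y k)) m) < e.
  move=> Nm mn; rewrite sub_series_geq//.
  apply: le_lt_trans (rnorm_sum _ _ _) _.
  apply: le_lt_trans (hN m n Nm mn); apply: le_trans (ler_norm _).
  by apply: ler_sum => k _; exact: inner_term_le.
exists N => m n Nm Nn; case: (leqP n m) => [nm|/ltnW mn]; first exact: bound.
by rewrite rnormB; exact: bound.
Qed.
Arguments inner_cvg : clear implicits.

Lemma innerDl x1 x2 y : inner (x1 + x2) y = inner x1 y + inner x2 y.
Proof.
apply: cvg_eq_unique (inner_cvg _ _) (cvgD (inner_cvg x1 y) (inner_cvg x2 y)).
move=> n; rewrite -[RHS]/(series _ n + series _ n) /series -big_split.
by apply: eq_bigr => k _ /=; rewrite -mulrDl.
Qed.

Lemma innerZl a x y : inner (a *: x) y = a * inner x y.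
Proof.
apply: cvg_eq_unique (inner_cvg _ _) (cvgM (cvg_cst a) (inner_cvg x y)) => n.
by rewrite /series/= mulr_sumr; apply: eq_bigr => k _; rewrite mulrA.
Qed.

Lemma conj_inner x y : conj_scal (inner x y) = inner y x.
Proof.
apply: cvg_eq_unique (cvg_conj_scal (inner_cvg x y)) (inner_cvg _ _) => n.
rewrite /series/= conj_scal_sum; apply: eq_bigr => k _.
by rewrite conj_scalM conj_scalK mulrC.
Qed.

Lemma inner_self x : inner x x = of_real (rnorm x ^+ 2).
Proof.
apply: cvg_eq_unique (inner_cvg _ _) (cvg_of_real (ell2_series_sqr x)) => n.
by rewrite /series/= of_real_sum; apply: eq_bigr => k _; rewrite mul_conj_scal.
Qed.

Lemma innerDr x y1 y2 : inner x (y1 + y2) = inner x y1 + inner x y2.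
Proof. by rewrite -conj_inner innerDl conj_scalD !conj_inner. Qed.

Lemma innerZr a x y : inner x (a *: y) = conj_scal a * inner x y.
Proof. by rewrite -conj_inner innerZl conj_scalM conj_inner. Qed.

Lemma inner0l y : inner 0 y = 0.
Proof. by rewrite -(scale0r 0) innerZl mul0r. Qed.

Lemma inner0r x : inner x 0 = 0.
Proof. by rewrite -conj_inner inner0l; exact: conj_scal_nat 0%N. Qed.

Lemma innerNl x y : inner (- x) y = - inner x y.
Proof. by rewrite -scaleN1r innerZl mulN1r. Qed.

Lemma innerBl x1 x2 y : inner (x1 - x2) y = inner x1 y - inner x2 y.
Proof. by rewrite innerDl innerNl. Qed.

Lemma inner_suml (I : Type) (s : seq I) (P : pred I) (f : I -> ell2) y :
  inner (\sum_(i <- s | P i) f i) y = \sum_(i <- s | P i) inner (f i) y.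
Proof. by elim/big_rec2 : _ => [|i a x _ <-]; rewrite ?inner0l ?innerDl. Qed.

Lemma inner_sumr (I : Type) (s : seq I) (P : pred I) (f : I -> ell2) x :
  inner x (\sum_(i <- s | P i) f i) = \sum_(i <- s | P i) inner x (f i).
Proof. by elim/big_rec2 : _ => [|i a y _ <-]; rewrite ?inner0r ?innerDr. Qed.

Lemma rnorm_inner_sqr_le x y : rnorm (inner x y) <= rnorm x ^+ 2 + rnorm y ^+ 2.
Proof.
have h1 := cvg_rnorm (inner_cvg x y).
apply: ler_cvg_to h1 (ell2_series_sqrD x y) _; near=> n.
apply: le_trans (rnorm_sum _ _ _) _.
by apply: ler_sum => k _; exact: inner_term_le.
Unshelve. all: by end_near. Qed.

(* The factor 2 is not sharp, but this form of the Cauchy-Schwarz inequality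
   follows by homogeneity from [rnorm_inner_sqr_le] and continuity of the inner
   product is all that is needed of it. *)
Lemma rnorm_inner_le x y : rnorm (inner x y) <= 2 * rnorm x * rnorm y.
Proof.
have [/rnorm0_eq0 ->|x0] := eqVneq (rnorm x) 0.
  by rewrite inner0l !rnorm0 mulr0 mul0r.
have [/rnorm0_eq0 ->|y0] := eqVneq (rnorm y) 0.
  by rewrite inner0r !rnorm0 mulr0.
have := rnorm_inner_sqr_le
  (of_real (rnorm x)^-1 *: x) (of_real (rnorm y)^-1 *: y).
rewrite innerZl innerZr conj_scal_of_real !rnormM !rnormZ !rnorm_of_real.
have xp : 0 < rnorm x by rewrite lt_neqAle eq_sym x0 rnorm_ge0.
have yp : 0 < rnorm y by rewrite lt_neqAle eq_sym y0 rnorm_ge0.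
rewrite !ger0_norm ?invr_ge0 ?rnorm_ge0// !mulVf// expr1n mulrA -invfM.
by rewrite ler_pdivrMl ?mulr_gt0// => /le_trans; apply; rewrite mulrC mulrA.
Qed.

Lemma inner_cvgl (u : nat -> ell2) (l y : ell2) :
  u @ \oo --> l -> (fun n => inner (u n) y) @ \oo --> inner l y.
Proof.
apply: (@cvg_le_rnorm _ _ _ _ (2 * rnorm y)) => n.
by rewrite -innerBl (le_trans (rnorm_inner_le _ _))// mulrAC.
Qed.

Lemma rnormD_sqr x y : inner x y = 0 ->
  rnorm (x + y) ^+ 2 = rnorm x ^+ 2 + rnorm y ^+ 2.
Proof.
move=> xy; apply: (@of_real_inj R F).
rewrite of_realD -!inner_self innerDl !innerDr xy -(conj_inner x y) xy.
by rewrite (conj_scal_nat 0) addr0 add0r.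
Qed.

End Inner.
Arguments inner_cvg {R F} x y.
Arguments inner_cvgl {R F u l} y _.
Arguments ell2_series_sqr {R F} x.

(** * Completeness of l_2, orthonormal systems and Bessel's inequality *)

Section Ell2.
Context {R : realType} {F : scalars}.
Local Notation K := (scal R F).
Local Notation ell1 := (ell1 R F).
Local Notation ell2 := (ell2 R F).

Lemma coord_le_rnorm (x : ell2) k : rnorm (x k) <= rnorm x.
Proof.
have fx : lpnorm 2 x \is a fin_num by rewrite ge0_fin_numE ?lpnorm_ge0 ?lpP.
by rewrite rnorm_lpE -lee_fin fineK//; apply/lpnorm_coord/le1_2.
Qed.

(** A Fatou argument: a finite partial sum of squares is continuous in its coordinates, so the
    uniform bound [M ^+ 2] survives the limit, and it then holds for the whole series. Completeness
    uses this twice, to place the limit in l_2 and to estimate the distance to it. *)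
Lemma ell2_coord_limit (u : nat -> ell2) (x : nat -> K) (M : R) :
  (forall k, (fun n => u n k) @ \oo --> x k) -> (forall n, rnorm (u n) <= M) ->
  exists2 y : ell2, lp_seq y = x & rnorm y <= M.
Proof.
move=> ux uM.
have M0 : 0 <= M by exact: le_trans (rnorm_ge0 _) (uM 0%N).
have xM : (\sum_(k <oo) (rnorm (x k) ^+ 2)%:E <= (M ^+ 2)%:E)%E.
  apply: nneseries_le_partial => [k|J]; first exact: sqr_ge0.
  have lim : (fun n => \sum_(0 <= k < J) rnorm (u n k) ^+ 2) @ \oo -->
      \sum_(0 <= k < J) rnorm (x k) ^+ 2.
    elim: J => [|J ih].
      under eq_fun do rewrite big_geq//.
      by rewrite big_geq//; exact: cvg_cst.
    under eq_fun do rewrite big_nat_recr//.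
    rewrite big_nat_recr//=; apply: cvgD => //; rewrite expr2.
    under eq_fun do rewrite expr2.
    by apply: cvgM; apply: cvg_rnorm.
  apply: cvgr_to_le lim _.
  near=> n.
  have : series (fun k => rnorm (u n k) ^+ 2) J <= rnorm (u n) ^+ 2.
    by apply: series_le_nneseries => [k|]; rewrite ?sqr_ge0// rnorm_ell2E.
  by move/le_trans; apply; rewrite ler_sqr ?nnegrE ?rnorm_ge0.
have xP : x \in lp_pred F 2.
  rewrite inE /= lpnormE// poweR_lty//.
  under eq_eseriesr do rewrite powR_mulrn ?rnorm_ge0//.
  exact: le_lt_trans xM (ltry _).
exists (Lp x xP) => //.
by rewrite -ler_sqr ?nnegrE ?rnorm_ge0// -lee_fin rnorm_ell2E.
Unshelve. all: by end_near. Qed.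

Lemma cauchy_ell2_cvg (u : nat -> ell2) :
  (forall e : R, 0 < e -> exists N, forall m n, (N <= m)%N -> (N <= n)%N ->
    rnorm (u m - u n) < e) -> cvgn u.
Proof.
move=> cu.
have /choice[x ux] k : exists l : K, (fun n => u n k) @ \oo --> l.
  apply/cvg_ex; apply: cauchy_scal_cvg => e /cu[N hN].
  exists N => m n mN nN; apply: le_lt_trans (hN m n mN nN).
  exact: (coord_le_rnorm (u m - u n)).
(* From [N0] on the sequence stays within 1 of [u N0]; the shifted sequence is thus bounded at every
   index. *)
have [N0 hN0] := cu 1 ltr01.
have ushift N k : (fun n => u (n + N)%N k) @ \oo --> x k.
  by rewrite (cvg_shiftn N (fun n => u n k)).
have [y yx _] : exists2 y : ell2, lp_seq y = x & rnorm y <= rnorm (u N0) + 1.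
  apply: (ell2_coord_limit (u := fun n => u (n + N0)%N)) => // n.
  rewrite -[u (n + N0)%N](subrKC (u N0)) (le_trans (ler_rnormD _ _))// lerD2l.
  by rewrite ltW// hN0// leq_addl.
apply/cvg_ex; exists y; apply/cvg_rnormP => e e0.
have [N hN] := cu (e / 2) (divr_gt0 e0 (ltr0Sn _ 1)).
exists N => // n /= nN.
(* For fixed [n], the differences [u (m + N) - u n] tend coordinatewise to [y - u n] as m grows, so
   their bound [e / 2] passes to it. *)
have [z zE ze] : exists2 z : ell2,
    lp_seq z = (y - u n : ell2) & rnorm z <= e / 2.
  apply: (ell2_coord_limit (u := fun m => u (m + N)%N - u n)) => [k|m].
    have uy : (fun m => u (m + N)%N k) @ \oo --> y k.
      by rewrite yx; exact: ushift.
    by apply: (cvgB uy); exact: cvg_cst.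
  by rewrite ltW// hN// leq_addl.
rewrite -(val_inj zE) (le_lt_trans ze)//; lra.
Qed.

Lemma rnorm_sum_orth (I : eqType) (s : seq I) (f : I -> ell2) : uniq s ->
  (forall i j, i != j -> inner (f i) (f j) = 0) ->
  rnorm (\sum_(i <- s) f i) ^+ 2 = \sum_(i <- s) rnorm (f i) ^+ 2.
Proof.
move=> + fo; elim: s => [_|i s ih /= /andP[is_ us]].
  by rewrite !big_nil rnorm0 expr0n.
rewrite !big_cons rnormD_sqr ?ih// inner_sumr big_seq big1// => j js.
by apply: fo; apply: contraNneq is_ => ->.
Qed.

Lemma inner_deltar (x : ell2) k : inner x (delta k) = x k.
Proof.
suff lim : series (fun j => x j * conj_scal (@delta R F k j)) @ \oo --> x k.
  by apply: cvg_eq_unique (inner_cvg x (delta k)) lim.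
apply: cvg_near_cst; exists k.+1 => // n /= kn.
rewrite /series/= (bigD1_seq k) ?mem_index_iota ?iota_uniq//= eqxx.
rewrite (conj_scal_nat 1) mulr1 big1 ?addr0// => j /negbTE ->.
by rewrite (conj_scal_nat 0) mulr0.
Qed.

Lemma delta_orthonormal : orthonormal (@delta R F).
Proof. by move=> j k; rewrite inner_deltar /= eq_sym. Qed.

Section Orthonormal.
Variable e : nat -> ell2.
Hypothesis eo : orthonormal e.

Lemma orthonormal_rnorm k : rnorm (e k) = 1.
Proof.
have := eo k k; rewrite eqxx inner_self -(@of_real1 R F) => /of_real_inj/eqP.
by rewrite sqrp_eq1 ?rnorm_ge0// => /eqP.
Qed.

Lemma orthonormal_scale_orth (c : nat -> K) i j :
  i != j -> inner (c i *: e i) (c j *: e j) = 0.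
Proof. by move=> /negbTE ij; rewrite innerZl innerZr eo ij !mulr0. Qed.

Lemma orthonormal_rnorm_sum (c : nat -> K) m n :
  rnorm (\sum_(m <= k < n) c k *: e k) ^+ 2 =
  \sum_(m <= k < n) rnorm (c k) ^+ 2.
Proof.
rewrite rnorm_sum_orth ?iota_uniq//; last exact: orthonormal_scale_orth.
by apply: eq_bigr => k _; rewrite rnormZ orthonormal_rnorm mulr1.
Qed.

(** Pythagoras: the residual of [v] is orthogonal to each [e k] with [k < n], hence to the partial
    expansion. *)
Lemma bessel_eq v n :
  rnorm (v - series (fun k => rank_one (e k) v) n) ^+ 2 +
  series (fun k => rnorm (inner v (e k)) ^+ 2) n = rnorm v ^+ 2.
Proof.
rewrite /series/= -(orthonormal_rnorm_sum (fun k => inner v (e k))).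
rewrite -rnormD_sqr ?subrK// inner_sumr.
rewrite big1_seq// => k /=; rewrite mem_index_iota => /andP[_ kn].
rewrite innerZr innerBl inner_suml (bigD1_seq k) ?mem_index_iota ?iota_uniq//=.
rewrite innerZl eo eqxx mulr1 big1 ?addr0 ?subrr ?mulr0// => j jk.
by rewrite innerZl eo (negbTE jk) mulr0.
Qed.

Lemma bessel v n :
  series (fun k => rnorm (inner v (e k)) ^+ 2) n <= rnorm v ^+ 2.
Proof. by rewrite -(bessel_eq v n) lerDr sqr_ge0. Qed.

Lemma orthonormal_series_cvg (c : nat -> K) (M : R) :
  (forall n, series (fun k => rnorm (c k) ^+ 2) n <= M) ->
  cvgn (series (fun k => c k *: e k)).
Proof.
move=> cM.
have c0 k : 0 <= rnorm (c k) ^+ 2 by exact: sqr_ge0.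
have : (\sum_(k <oo) (rnorm (c k) ^+ 2)%:E)%E \is a fin_num.
  rewrite ge0_fin_numE; last by apply: nneseries_ge0 => *; rewrite lee_fin.
  exact: le_lt_trans (nneseries_le_partial c0 cM) (ltry _).
move=> /fineK/esym/(nneseries_cvg_series c0)/cvg_series_tail tail.
(* The tail is made smaller than [d ^+ 2] because a block of the vector series has as squared norm
   the matching block of squared coefficients. *)
apply: cauchy_ell2_cvg => d d0; have [N hN] := tail (d ^+ 2) (exprn_gt0 2 d0).
have bound m n : (N <= m)%N -> (m <= n)%N ->
    rnorm (series (fun k => c k *: e k) n - series (fun k => c k *: e k) m) < d.
  move=> Nm mn; rewrite -ltr_sqr ?nnegrE ?rnorm_ge0 ?(ltW d0)//.
  rewrite sub_series_geq// orthonormal_rnorm_sum.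
  exact: le_lt_trans (ler_norm _) (hN m n Nm mn).
exists N => m n Nm Nn; case: (leqP n m) => [nm|/ltnW mn]; first exact: bound.
by rewrite rnormB; exact: bound.
Qed.

End Orthonormal.
End Ell2.

(** * Existence of the positive square root and its values on eigenvectors *)

Section SqrtOperator.
Context {R : realType} {F : scalars}.
Local Notation K := (scal R F).
Local Notation ell2 := (ell2 R F).

Lemma linear_of_fun (U V : lmodType K) (f : U -> V) :
  linear f -> exists g : {linear U -> V}, g =1 f.
Proof.
move=> lf; pose m := GRing.isLinear.Build K U V *:%R f lf.
by pose g : {linear U -> V} := HB.pack f m; exists g.
Qed.

(** For [lambda] equal to 0, [|S x|^2 = <A x, x> = 0]. Otherwise [w = S x - sqrt(lambda) x]
    satisfies [S w = - sqrt(lambda) w], and positivity of [S] forces [w = 0]. The value at [x] is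
    thus the same for every positive root, whichever one [sqrt_op] picks. *)
Lemma positive_sqrt_eigen (A S : {linear ell2 -> ell2}) (x : ell2)
    (lambda : R) :
  is_positive_sqrt A S -> 0 <= lambda -> A x = of_real lambda *: x ->
  S x = of_real (Num.sqrt lambda) *: x.
Proof.
move=> [_ Ssa S0 SS] l0 Ax; have [lz|ln] := eqVneq lambda 0.
  rewrite lz sqrtr0 of_real0 scale0r; apply: rnorm0_eq0; apply/eqP.
  rewrite -sqrf_eq0; apply/eqP/(@of_real_inj R F).
  by rewrite -inner_self -Ssa SS Ax lz of_real0 scale0r inner0l.
set r := Num.sqrt lambda; apply/eqP; rewrite -subr_eq0; apply/eqP.
set w := S x - _; have Sw : S w = of_real (- r) *: w.
  rewrite /w linearB linearZ/= SS Ax scalerBr scalerA -of_realM mulNr -expr2.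
  by rewrite sqr_sqrtr// !of_realN !scaleNr opprK addrC.
have r0 : 0 < r by rewrite sqrtr_gt0 lt_neqAle eq_sym ln.
have := S0 w.
rewrite Sw innerZl inner_self -of_realM -(@of_real0 R F) ler_of_real.
rewrite mulNr oppr_ge0 pmulr_rle0// => w0; apply: rnorm0_eq0.
by apply/eqP; rewrite -sqrf_eq0 eq_le w0 sqr_ge0.
Qed.

(** Nonnegativity in [K] includes being real, so the limit is first identified with its own real
    part by uniqueness of limits. *)
Lemma cvg_ge0_of_real (u : nat -> R) (l : K) : (forall n, 0 <= u n) ->
  (fun n => of_real (u n) : K) @ \oo --> l -> 0 <= l.
Proof.
move=> u0 ul.
have rl : u @ \oo --> re_scal l.
  by have := cvg_re_scal ul; under eq_fun do rewrite of_realK.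
rewrite (cvg_eq_unique (frefl _) ul (cvg_of_real (F := F) rl)).
rewrite -(@of_real0 R F) ler_of_real; apply: cvgr_to_ge rl _.
by near=> n.
Unshelve. all: by end_near. Qed.

Lemma eigendecomposition_sqrt (A : {linear ell2 -> ell2}) (lambda : nat -> R)
    (e : nat -> ell2) : bounded_op A -> eigendecomposition A lambda e ->
  exists S, is_positive_sqrt A S.
Proof.
move=> [M AM] [eo l0 Ae Asum].
(* Testing the operator bound on the unit vectors [e k] bounds the eigenvalues; with Bessel this
   makes the coefficients [sqrt(lambda_k) <v, e_k>] square summable. *)
have lM k : lambda k <= M.
  have := AM (e k); rewrite Ae rnormZ rnorm_of_real (orthonormal_rnorm eo).
  by rewrite !mulr1 ger0_norm.
have M0 : 0 <= M := le_trans (l0 0%N) (lM 0%N).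
pose r k := Num.sqrt (lambda k).
have rr k : r k * r k = lambda k by rewrite -expr2 sqr_sqrtr.
pose s v n : ell2 :=
  series (fun k => (of_real (r k) * inner v (e k)) *: e k) n.
have sM v n : series (fun k => rnorm (of_real (r k) * inner v (e k)) ^+ 2) n
    <= M * rnorm v ^+ 2.
  apply: le_trans (ler_wpM2l M0 (bessel eo v n)).
  rewrite /series/= mulr_sumr; apply: ler_sum => k _.
  rewrite rnormM exprMn; apply: ler_wpM2r; first exact: sqr_ge0.
  by rewrite rnorm_of_real real_normK ?num_real// expr2 rr.
pose f v := limn (s v).
have sf v : s v @ \oo --> f v := orthonormal_series_cvg eo (sM v).
have f_lin : linear f.
  move=> a x y.
  apply: cvg_eq_unique (sf _) (cvgD (cvgZ (cvg_cst a) (sf x)) (sf y)) => n.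
  rewrite -[RHS]/(a *: s x n + s y n) /s /series scaler_sumr -big_split.
  apply: eq_bigr => k _ /=.
  by rewrite scalerA -scalerDl innerDl innerZl mulrDr mulrCA.
have [S Sf] := linear_of_fun f_lin.
have sS v : s v @ \oo --> S v by rewrite Sf.
have S_le v : rnorm (S v) <= Num.sqrt M * rnorm v.
  apply: cvgr_to_le (cvg_rnorm (sS v)) _; near=> n.
  rewrite -ler_sqr ?nnegrE ?mulr_ge0 ?sqrtr_ge0 ?rnorm_ge0//.
  by rewrite exprMn sqr_sqrtr// (orthonormal_rnorm_sum eo); exact: sM.
have inner_s x y n : inner (s x n) y =
    \sum_(0 <= k < n)
      of_real (r k) * (inner x (e k) * conj_scal (inner y (e k))).
  rewrite inner_suml; apply: eq_bigr => k _.
  by rewrite innerZl conj_inner mulrA.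
have Se k : S (e k) = of_real (r k) *: e k.
  suff lim : s (e k) @ \oo --> of_real (r k) *: e k.
    by apply: cvg_eq_unique (sS _) lim.
  apply: cvg_near_cst; exists k.+1 => // n /= kn.
  rewrite /s /series/= (bigD1_seq k) ?mem_index_iota ?iota_uniq//=.
  rewrite eo eqxx mulr1.
  by rewrite big1 ?addr0// => j jk; rewrite eo eq_sym (negbTE jk) mulr0 scale0r.
exists S; split.
- by exists (Num.sqrt M).
(* The partial sums of the root are symmetric, and symmetry passes to the limit. *)
- move=> x y; rewrite -(conj_inner (S y) x).
  apply: cvg_eq_unique (inner_cvgl y (sS x))
    (cvg_conj_scal (inner_cvgl x (sS y))) => n /=.
  rewrite !inner_s conj_scal_sum; apply: eq_bigr => k _.
  by rewrite !conj_scalM conj_scalK conj_scal_of_real (mulrC (inner x _)).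
- move=> x; apply: (@cvg_ge0_of_real
      (fun n => \sum_(0 <= k < n) r k * rnorm (inner x (e k)) ^+ 2)).
    by move=> n; apply: sumr_ge0 => k _; rewrite mulr_ge0 ?sqrtr_ge0 ?sqr_ge0.
  have := inner_cvgl x (sS x); under eq_fun do rewrite inner_s.
  under [in X in _ -> X]eq_fun do rewrite of_real_sum.
  under [in X in _ -> X]eq_fun do
    under eq_bigr do rewrite of_realM -mul_conj_scal.
  by [].
(* By continuity [S] may be applied term by term to its own expansion; since
   [S e_k = sqrt(lambda_k) e_k], the result is the eigenexpansion of [A]. *)
- move=> x; have lim : S \o s x @ \oo --> S (S x).
    apply: cvg_le_rnorm (sS x) => n; rewrite /= -linearB; exact: S_le.
  apply: cvg_eq_unique lim (Asum x) => n.
  rewrite /= linear_sum; apply: eq_bigr => k _.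
  by rewrite linearZ /= Se scalerA mulrAC -of_realM rr /rank_one scalerA.
Unshelve. all: by end_near. Qed.

Lemma sqrt_opP (A : {linear ell2 -> ell2}) :
  (exists S, is_positive_sqrt A S) -> is_positive_sqrt A (sqrt_op A).
Proof.
by rewrite /sqrt_op; case: pselect => // ex_S _; exact: (projT2 (cid ex_S)).
Qed.

End SqrtOperator.

(** * 2-summing operators on orthogonal systems, and the inclusion of l_1 in l_2 *)

Section TwoSummingEll2.
Context {R : realType} {F : scalars}.
Local Notation K := (scal R F).
Local Notation ell1 := (ell1 R F).
Local Notation ell2 := (ell2 R F).

(** Conjugate coefficients make [phi] of the test vector equal to the sum [S] itself, while
    orthogonality and [|f_i| <= 1] bound the squared norm of that vector by [S]. Hence
    [S ^+ 2 <= S], with no representation of [phi] by a vector. *)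
Lemma dual_ball_orth (I : eqType) (s : seq I) (f : I -> ell2)
    (phi : {linear ell2 -> K^o}) : uniq s -> dual_ball phi ->
  (forall i j, i != j -> inner (f i) (f j) = 0) ->
  (forall i, rnorm (f i) <= 1) -> \sum_(i <- s) rnorm (phi (f i)) ^+ 2 <= 1.
Proof.
move=> us phi1 fo f1; pose c i := conj_scal (phi (f i)).
set S := \sum_(i <- s) _.
have S0 : 0 <= S by apply: sumr_ge0 => i _; exact: sqr_ge0.
have := phi1 (\sum_(i <- s) c i *: f i).
rewrite linear_sum (_ : \sum_(i <- s) _ = of_real S); last first.
  rewrite of_real_sum; apply: eq_bigr => i _.
  by rewrite linearZ /= -mul_conj_scal mulrC.
rewrite rnorm_of_real (ger0_norm S0) => Sle.
have : S ^+ 2 <= S.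
  apply: (@le_trans _ _ (rnorm (\sum_(i <- s) c i *: f i) ^+ 2)).
    by rewrite ler_sqr ?nnegrE ?rnorm_ge0.
  rewrite rnorm_sum_orth//; last first.
    by move=> i j ij; rewrite innerZl innerZr fo ?mulr0.
  apply: ler_sum => i _; rewrite rnormZ rnorm_conj exprMn ler_piMr ?sqr_ge0//.
  by rewrite expr_le1// rnorm_ge0.
by move: S0; clear; nra.
Qed.

Section Bound.
Context {Y : normedModType K} {T : {linear ell2 -> Y}} {C : R}.
Hypothesis TC : two_summing_bound T C.

Lemma two_summing_orth (f : nat -> ell2) :
  (forall i j, i != j -> inner (f i) (f j) = 0) ->
  (forall i, rnorm (f i) <= 1) ->
  (\sum_(k <oo) (rnorm (T (f k)) ^+ 2)%:E <= (C ^+ 2)%:E)%E.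
Proof.
move=> fo f1; apply: nneseries_le_partial => [k|n]; first exact: sqr_ge0.
rewrite -lee_fin /series/= big_mkord.
apply: le_trans (TC.2 n (fun k => f k)) _.
rewrite -[leRHS]mule1; apply: lee_wpmul2l; first by rewrite lee_fin sqr_ge0.
apply: ge_ereal_sup => _ [phi phi1 <-]; rewrite lee_fin.
apply: (@dual_ball_orth _ _ (fun k : 'I_n => f k)) => //.
  exact: index_enum_uniq.
by move=> i j ij; apply: fo.
Qed.

(** The 2-summing inequality for a single vector; the resulting continuity of [T] allows an l_2
    expansion to be pushed forward. *)
Lemma two_summing_bounded x : rnorm (T x) <= C * rnorm x.
Proof.
have [C0 /(_ 1 (fun=> x))] := TC; rewrite big_ord1 => h.
rewrite -ler_sqr ?nnegrE ?mulr_ge0 ?rnorm_ge0// exprMn -lee_fin (le_trans h)//.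
rewrite [leRHS]EFinM; apply: lee_wpmul2l; first by rewrite lee_fin sqr_ge0.
apply: ge_ereal_sup => _ [phi phi1 <-].
by rewrite big_ord1 lee_fin ler_sqr ?nnegrE ?rnorm_ge0.
Qed.

End Bound.

Lemma incl_is_linear : linear (@incl R F).
Proof. by move=> a x y; apply: val_inj. Qed.

HB.instance Definition _ :=
  GRing.isLinear.Build K ell1 ell2 *:%R (@incl R F) incl_is_linear.

Lemma rnorm_incl (x : ell1) : rnorm (incl x) <= rnorm x.
Proof.
rewrite -ler_sqr ?nnegrE ?rnorm_ge0// -lee_fin rnorm_ell2E.
apply: nneseries_le_partial => [k|n]; first exact: sqr_ge0.
(* For nonnegative terms the sum of squares is at most the square of the sum. *)
apply: (@le_trans _ _ (series (fun k => rnorm (x k)) n ^+ 2)).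
  rewrite /series/=; elim: n => [|n ih]; first by rewrite !big_geq// expr0n.
  rewrite !big_nat_recr//= sqrrD (le_trans (lerD ih (lexx _)))//.
  rewrite lerD2r lerDl mulrn_wge0// mulr_ge0 ?rnorm_ge0//.
  by apply: sumr_ge0 => k _; exact: rnorm_ge0.
have sx : series (fun k => rnorm (x k)) n <= rnorm x.
  by apply: series_le_nneseries => [k|]; rewrite ?rnorm_ge0// -rnorm_ell1E.
rewrite ler_sqr ?nnegrE ?rnorm_ge0//; apply: sumr_ge0 => k _; exact: rnorm_ge0.
Qed.

Lemma lpnorm_ell1 (x : ell1) : lpnorm 1 x = (rnorm x)%:E.
Proof.
by rewrite rnorm_lpE fineK// ge0_fin_numE ?lpnorm_ge0 ?lpP.
Qed.

Lemma gamma_plus_le (A : {linear ell2 -> ell2}) (x : nat -> ell1) :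
  strong_sum (fun k => rank_one (incl (x k))) A ->
  (gamma_plus A <= \sum_(k <oo) (rnorm (x k) ^+ 2)%:E)%E.
Proof. by move=> xA; apply: ereal_inf_lbound; exists x. Qed.

(** In [bessel_eq] the coefficients along [delta] are the coordinates of [v], so the squared
    residual is exactly the tail of the series for [|v|^2]. *)
Lemma delta_expansion (v : ell2) :
  series (fun k => rank_one (delta k) v) @ \oo --> v.
Proof.
apply/cvg_rnormP => d d0.
have /cvgrPdist_lt/(_ _ (exprn_gt0 2 d0)) := ell2_series_sqr v.
apply: filterS => n; rewrite -(bessel_eq delta_orthonormal v n).
under [X in _ + X - _]eq_bigr do rewrite inner_deltar.
rewrite addrK ger0_norm ?sqr_ge0// ltr_sqr ?nnegrE ?rnorm_ge0 ?ltW//.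
Qed.

(** * Decompositions of A obtained from A = T T^* *)

Section Factorization.
Context {A : {linear ell2 -> ell2}} {T : {linear ell2 -> ell1}}.
Context {Tstar : {linear ell2 -> ell2}} {C : R}.
Hypothesis TTs : is_adjoint (incl \o T) Tstar.
Hypothesis ATT : forall x, A x = incl (T (Tstar x)).
Hypothesis TC : two_summing_bound T C.

Lemma factorization_strong_sum (e : nat -> ell2) :
  (forall v, series (fun k => rank_one (e k) v) @ \oo --> v) ->
  strong_sum (fun k => rank_one (incl (T (e k)))) A.
Proof.
move=> ev v; rewrite ATT.
apply: (@cvg_le_rnorm _ _ _ _ C _ _ _ _ _ (ev (Tstar v))) => n.
apply: le_trans (two_summing_bounded TC _); rewrite linearB /=.
apply: le_trans (rnorm_incl _); rewrite [leRHS]/rnorm linearB /= -/(rnorm _).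
(* Equality holds here: since [<T^* v, e_k> = <v, T e_k>], the operator [incl \o T] sends
   [rank_one (e k) (Tstar v)] to [rank_one (incl (T (e k))) v]. *)
rewrite le_eqVlt; apply/orP; left; apply/eqP; congr (rnorm (_ - _)).
rewrite !linear_sum; apply: eq_bigr => k _ /=.
rewrite /rank_one !linearZ /=; congr (_ *: _).
by rewrite -conj_inner -[incl (T _)]/((incl \o T) (e k)) TTs conj_inner.
Qed.

Lemma factorization_gamma_plus : (gamma_plus A <= (C ^+ 2)%:E)%E.
Proof.
apply: le_trans (gamma_plus_le (factorization_strong_sum delta_expansion)) _.
apply: (two_summing_orth TC) => [i j /negbTE ij|i].
  by rewrite delta_orthonormal ij.
by rewrite (orthonormal_rnorm delta_orthonormal).
Qed.

Context {lambda : nat -> R} {e : nat -> ell2}.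
Hypothesis Ae : eigendecomposition A lambda e.

Let r k : R := Num.sqrt (lambda k).
Let f k : ell2 := of_real (r k)^-1 *: Tstar (e k).

(** Holds also for a zero eigenvalue because the inverse of 0 is 0; this is what makes [f k] vanish
    there without a case distinction. *)
Let divr_sqrt k : (r k)^-1 * lambda k = r k.
Proof.
have [_ l0 _ _] := Ae; have [r0|r0] := eqVneq (r k) 0.
  by rewrite r0 invr0 mul0r.
by rewrite -[lambda k]sqr_sqrtr// expr2 mulKf.
Qed.

Lemma incl_factor_eigen k : incl (T (f k)) = of_real (r k) *: e k.
Proof.
have [_ _ Aek _] := Ae.
by rewrite /f !linearZ /= -ATT Aek scalerA -of_realM divr_sqrt.
Qed.

(** Moving [Tstar] across gives [<T^* e_i, T^* e_j> = <A e_i, e_j>], so orthogonality of the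
    eigenvectors is inherited. *)
Lemma adjoint_eigen_inner i j :
  inner (f i) (f j) = of_real ((r i)^-1 * (r j)^-1 * lambda i) * (i == j)%:R.
Proof.
have [eo _ Aek _] := Ae.
rewrite innerZl innerZr conj_scal_of_real -TTs /= -ATT Aek innerZl eo.
by rewrite !mulrA -!of_realM.
Qed.

Lemma eigen_sum_le_two_summing :
  (\sum_(k <oo) (rnorm (T (f k)) ^+ 2)%:E <= (C ^+ 2)%:E)%E.
Proof.
apply: (two_summing_orth TC) => [i j /negbTE ij|i].
  by rewrite adjoint_eigen_inner ij mulr0.
rewrite -(@expr_le1 _ 2)// ?rnorm_ge0// -(ler_of_real F) -inner_self.
rewrite adjoint_eigen_inner eqxx mulr1 ler_of_real -mulrA divr_sqrt.
(* What remains is [(r i)^-1 * r i <= 1], whose left side is 0 or 1. *)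
have [->|r0] := eqVneq (r i) 0; first by rewrite mulr0.
by rewrite mulVf.
Qed.

(** The vector [e k] need not lie in l_1, hence [lpnorm] on the right; if [lambda k] is 0, both
    sides vanish because 0 times infinity is 0 in [\bar R]. *)
Lemma eigen_term k :
  ((rnorm (T (f k)) ^+ 2)%:E = (lambda k)%:E * lpnorm 1 (e k) ^+ 2)%E.
Proof.
have [_ l0 _ _] := Ae.
rewrite -[in RHS](sqr_sqrtr (l0 k)) -/(r k) !expr2 !EFinM -lpnorm_ell1.
rewrite (_ : lp_seq (T (f k)) = of_real (r k) *: (e k : nat -> K)); last first.
  by rewrite -[LHS]/(lp_seq (incl (T (f k)))) incl_factor_eigen.
rewrite lpnormZ ?lexx// rnorm_of_real ger0_norm ?sqrtr_ge0//.
by rewrite muleACA.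
Qed.

(** The vectors [sqrt(lambda_k) e_k] are admissible in the infimum since they are the l_1 vectors
    [T (f k)]; their rank-one operators are the terms of the eigendecomposition. *)
Lemma eigen_gamma_plus :
  (gamma_plus A <= \sum_(k <oo) (rnorm (T (f k)) ^+ 2)%:E)%E.
Proof.
have [_ l0 _ Asum] := Ae.
apply: (@gamma_plus_le _ (T \o f)) => v.
apply: cvg_trans (Asum v); apply: near_eq_cvg; near=> n.
apply: eq_bigr => k _ /=; rewrite incl_factor_eigen /rank_one innerZr.
rewrite conj_scal_of_real !scalerA; congr (_ *: _).
by rewrite mulrAC -of_realM -expr2 sqr_sqrtr.
Unshelve. all: by end_near. Qed.

End Factorization.

Lemma sqrt_op_eigen_term (A : {linear ell2 -> ell2}) lambda e k :
  bounded_op A -> eigendecomposition A lambda e ->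
  (lpnorm 1 (sqrt_op A (e k)) ^+ 2 = (lambda k)%:E * lpnorm 1 (e k) ^+ 2)%E.
Proof.
move=> Ab Ae; have [_ l0 Aek _] := Ae.
have /sqrt_opP/positive_sqrt_eigen/(_ (l0 k) (Aek k)) -> :=
  eigendecomposition_sqrt Ab Ae.
rewrite [lp_seq _](_ : _ = of_real (Num.sqrt (lambda k)) *: (e k : nat -> K))//.
rewrite lpnormZ ?lexx// rnorm_of_real ger0_norm ?sqrtr_ge0//.
by rewrite -[in RHS](sqr_sqrtr (l0 k)) !expr2 EFinM muleACA.
Qed.

Lemma pi2_ge0 (X Y : normedModType K) (T : {linear X -> Y}) : (0 <= pi2 T)%E.
Proof. by apply: le_ereal_inf_tmp => _ [C [C0 _] <-]; rewrite lee_fin. Qed.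

Lemma pi2_lty (X Y : normedModType K) (T : {linear X -> Y}) :
  two_summing T -> (pi2 T < +oo)%E.
Proof.
by case=> C TC; apply: le_lt_trans (ltry C); apply: ereal_inf_lbound; exists C.
Qed.

(** The infimum is taken over [C], not over its square, so the square root of [s] is compared with
    every [C] before squaring. A nonpositive [s] is trivial, and one admissible [C] rules out an
    infinite one. *)
Lemma le_pi2_sqr (X Y : normedModType K) (T : {linear X -> Y}) (s : \bar R) :
  two_summing T -> (forall C, two_summing_bound T C -> (s <= (C ^+ 2)%:E)%E) ->
  (s <= pi2 T ^+ 2)%E.
Proof.
move=> T2 sC; have [s0|s0] := leP s 0%E.
  by apply: le_trans s0 _; rewrite expe2 mule_ge0 ?pi2_ge0.
have [C0 TC0] := T2.
case: s s0 sC => [s||] //; last by move=> _ /(_ _ TC0); rewrite leNgt ltry.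
rewrite lte_fin => s0 sC.
have sqrt_le : ((Num.sqrt s)%:E <= pi2 T)%E.
  apply: le_ereal_inf_tmp => _ [C TC <-]; rewrite lee_fin.
  by rewrite -(ger0_norm TC.1) -sqrtr_sqr ler_wsqrtr// -lee_fin sC.
rewrite -(sqr_sqrtr (ltW s0)) expr2 EFinM expe2.
by apply: lee_pmul => //; rewrite lee_fin sqrtr_ge0.
Qed.

End TwoSummingEll2.

Theorem theorem5p14 (R : realType) (F : scalars)
    (A : {linear ell2 R F -> ell2 R F}) (T : {linear ell2 R F -> ell1 R F}) :
  Gamma A -> two_summing T -> factors_through A T ->
  Gamma_plus A /\
  forall (lambda : nat -> R) (e : nat -> ell2 R F),
    eigendecomposition A lambda e ->
    [/\ (gamma_plus A <= \sum_(k <oo) lpnorm 1 (sqrt_op A (e k)) ^+ 2)%E,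
        (\sum_(k <oo) lpnorm 1 (sqrt_op A (e k)) ^+ 2 =
         \sum_(k <oo) (lambda k)%:E * lpnorm 1 (e k) ^+ 2)%E,
        (\sum_(k <oo) (lambda k)%:E * lpnorm 1 (e k) ^+ 2 <= pi2 T ^+ 2)%E &
        (pi2 T ^+ 2 < +oo)%E].
Proof.
move=> GA T2 [Tstar TTs ATT]; have [Ab _ _ _] := GA.
have [C TC] := T2; split.
  split=> //.
  (* Finiteness comes from one admissible constant and the expansion along the standard basis. *)
  exact: le_lt_trans (factorization_gamma_plus TTs ATT TC) (ltry _).
move=> lambda e Ae.
have sqrtE : (\sum_(k <oo) lpnorm 1 (sqrt_op A (e k)) ^+ 2 =
    \sum_(k <oo) (lambda k)%:E * lpnorm 1 (e k) ^+ 2)%E.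
  by apply: eq_eseriesr => k _; exact: sqrt_op_eigen_term.
split=> //.
- rewrite sqrtE; apply: le_trans (eigen_gamma_plus ATT Ae) _.
  by under eq_eseriesr do rewrite (eigen_term ATT Ae).
- apply: le_pi2_sqr => // C' TC'.
  under eq_eseriesr do rewrite -(eigen_term ATT Ae).
  exact: (eigen_sum_le_two_summing TTs ATT TC' Ae).
- have : pi2 T \is a fin_num by rewrite ge0_fin_numE ?pi2_ge0 ?pi2_lty.
  by move/fineK <-; rewrite -EFin_expe ltry.
Qed.
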